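(* The following strict inclusions hold, where $\mathbf A\subset\mathbf B$ means that $\mathbf A$ is a full subcategory of $\mathbf B$ and $\mathbf A\ne\mathbf B$. (1) $\mathbf{Top}_{\mathbb N}\subset\mathbf{Top}_{\mathbb I}\subset\mathbf{Top}_{\mathbb D}$ and $\mathbf{Top}_{\mathbb N'}\subset\mathbf{Top}_{\mathbb I'}\subset\mathbf{Top}_{\mathbb D'}$. (2) $\mathbf{Top}_{\mathbb D'}\subset\mathbf{Top}_{\mathbb D}\subset\mathbf{Top}$, $\ \mathbf{Top}_{\mathbb I'}\subset\mathbf{Top}_{\mathbb I}\subset\mathbf{TS}$, and $\mathbf{Top}_{\mathbb N'}\subset\mathbf{Top}_{\mathbb N}\subset\mathbf{Seq}$.
   Context: All spaces are $T_0$; $\mathbf{Top}$ is the category of $T_0$ spaces and continuous maps. For a class $\mathbb C$ of $T_0$ spaces, a subset $U$ of a space $X$ is $\mathbb C$-open if $k^{-1}(U)$ is open in $C$ for every $C\in\mathbb C$ and every continuous map $k:C\to X$; $X$ is $\mathbb C$-generated if every $\mathbb C$-open subset is open; $\mathbf{Top}_{\mathbb C}$ is the full subcategory of $\mathbf{Top}$ of $\mathbb C$-generated spaces. For a poset $P$ and $\infty\notin P$, with $\uparrow x=\{y\in P:x\le y\}$ for $x\in P$: $\beta_P$ is the topology on $P\cup\{\infty\}$ with subbase all $\uparrow x$ and $\uparrow x\cup\{\infty\}$, $x\in P$; $\gamma_P$ is the topology on $P\cup\{\infty\}$ with subbase all $\uparrow x\cup\{\infty\}$, $x\in P$. Directed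 posets and chains are non-empty; $N$ is the poset of natural numbers with its usual order. The six classes are: $\mathbb D=\{(D\cup\{\infty\},\beta_D): D$ a directed poset$\}$; $\mathbb D'=\{(D\cup\{\infty\},\gamma_D): D$ a directed poset with no largest element$\}$; $\mathbb I=\{(I\cup\{\infty\},\beta_I): I$ a chain$\}$; $\mathbb I'=\{(I\cup\{\infty\},\gamma_I): I$ a chain with no largest element$\}$; $\mathbb N=\{(N\cup\{\infty\},\beta_N)\}$; $\mathbb N'=\{(N\cup\{\infty\},\gamma_N)\}$. $\mathbf{Seq}$ is the category of ($T_0$) sequential spaces: a subset $U$ is open whenever every sequence converging to a point of $U$ is eventually in $U$. $\mathbf{TS}$ is the category of ($T_0$) transfinite sequential spaces: a subset $U$ is open whenever every transfinite sequence (net indexed by a non-zero ordinal) converging to a point of $U$ is eventually in $U$. Both are full subcategories of $\mathbf{Top}$. *)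

(* Defs.v *)
From HB Require Import structures.
From mathcomp Require Import all_boot all_order.
From mathcomp Require Import boolp classical_sets filter wochoice.
From mathcomp Require Import topology_structure separation_axioms.

Set Implicit Arguments.
Unset Strict Implicit.
Unset Printing Implicit Defensive.

Local Open Scope classical_set_scope.

(* A subcategory of the category of T0 spaces and continuous maps, as a set of
   objects together with a set of morphisms; [hom_ob] makes equality of such
   records mean equality of categories.  Spaces need not be inhabited:
   [topologicalType] is not pointed. *)
Record subcategory := Subcategory {
  ob : topologicalType -> Prop;
  hom : forall X Y : topologicalType, (X -> Y) -> Prop;
  ob_T0 : forall X, ob X -> kolmogorov_space X;
  hom_ob : forall (X Y : topologicalType) (f : X -> Y), hom f -> ob X /\ ob Y;
  hom_continuous :
    forall (X Y : topologicalType) (f : X -> Y), hom f -> continuous f;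
  hom_id : forall X, ob X -> hom (@id X);
  hom_comp : forall (X Y Z : topologicalType) (f : X -> Y) (g : Y -> Z),
    hom f -> hom g -> hom (g \o f)
}.

Definition full_subcategory (A B : subcategory) : Prop :=
  (forall X, ob A X -> ob B X) /\
  (forall (X Y : topologicalType) (f : X -> Y),
    ob A X -> ob A Y -> (hom A f <-> hom B f)).

Definition proper_full_subcategory (A B : subcategory) : Prop :=
  full_subcategory A B /\ A <> B.

Section FullOn.
Variable K : topologicalType -> Prop.

Let fob (X : topologicalType) : Prop := kolmogorov_space X /\ K X.
Let fhom (X Y : topologicalType) (f : X -> Y) : Prop :=
  [/\ fob X, fob Y & continuous f].

Fact full_on_T0 X : fob X -> kolmogorov_space X.
Proof. by case. Qed.

Fact full_on_ob (X Y : topologicalType) (f : X -> Y) :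
  fhom f -> fob X /\ fob Y.
Proof. by case. Qed.

Fact full_on_continuous (X Y : topologicalType) (f : X -> Y) :
  fhom f -> continuous f.
Proof. by case. Qed.

Fact full_on_id X : fob X -> fhom (@id X).
Proof. by move=> ?; split => // x. Qed.

Fact full_on_comp (X Y Z : topologicalType) (f : X -> Y) (g : Y -> Z) :
  fhom f -> fhom g -> fhom (g \o f).
Proof.
case=> oX oY cf [_ oZ cg]; split => // x.
by apply: continuous_comp; [exact: cf | exact: cg].
Qed.

Definition full_on : subcategory :=
  Subcategory full_on_T0 full_on_ob full_on_continuous full_on_id full_on_comp.

End FullOn.

Definition Top : subcategory := full_on (fun=> True).

Definition C_open (C : topologicalType -> Prop) (X : topologicalType)
    (U : set X) : Prop :=
  forall (S : topologicalType) (k : S -> X),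
    C S -> continuous k -> open (k @^-1` U).

Definition C_generated (C : topologicalType -> Prop) (X : topologicalType) :
    Prop :=
  forall U : set X, C_open C U -> open U.

Definition Top_gen (C : topologicalType -> Prop) : subcategory :=
  full_on (C_generated C).

Section PosetSpaces.
Context d (P : porderType d).

Definition up (x : P) : set P := [set y | (x <= y)%O].

(* The carrier P + {oo} is [option P], with [None] as the point at infinity. *)
Definition beta_subbase : set (set (option P)) :=
  range (fun x => Some @` up x) `|`
  range (fun x => (Some @` up x) `|` [set None]).

Definition gamma_subbase : set (set (option P)) :=
  range (fun x => (Some @` up x) `|` [set None]).

Definition beta_space : Type := option P.
Definition gamma_space : Type := option P.

HB.instance Definition _ := Choice.on beta_space.
HB.instance Definition _ :=
  @isSubBaseTopological.Build beta_space (set (option P)) beta_subbase id.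

HB.instance Definition _ := Choice.on gamma_space.
HB.instance Definition _ :=
  @isSubBaseTopological.Build gamma_space (set (option P)) gamma_subbase id.

Definition directed_poset : Prop :=
  [set: P] !=set0 /\ forall x y : P, exists z, (x <= z)%O /\ (y <= z)%O.

Definition no_largest : Prop := ~ exists m : P, forall x, (x <= m)%O.

End PosetSpaces.

Arguments beta_space {d} P.
Arguments gamma_space {d} P.
Arguments directed_poset {d} P.
Arguments no_largest {d} P.

Inductive class_D : topologicalType -> Prop :=
| Class_D d (P : porderType d) : directed_poset P -> class_D (beta_space P).

Inductive class_D' : topologicalType -> Prop :=
| Class_D' d (P : porderType d) :
    directed_poset P -> no_largest P -> class_D' (gamma_space P).

Inductive class_I : topologicalType -> Prop :=
| Class_I d (I : orderType d) : [set: I] !=set0 -> class_I (beta_space I).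

Inductive class_I' : topologicalType -> Prop :=
| Class_I' d (I : orderType d) :
    [set: I] !=set0 -> no_largest I -> class_I' (gamma_space I).

Inductive class_N : topologicalType -> Prop :=
| Class_N : class_N (beta_space nat).

Inductive class_N' : topologicalType -> Prop :=
| Class_N' : class_N' (gamma_space nat).

Definition sequential (X : topologicalType) : Prop :=
  forall U : set X,
    (forall (u : nat -> X) (x : X), U x -> u @ \oo --> x ->
      \forall n \near \oo, U (u n)) ->
    open U.

Definition Seq : subcategory := full_on sequential.

Definition tails d (I : orderType d) : set_system I := filter_from setT (@up d I).
Arguments tails {d} I.

(* Ordinals are represented by well-ordered types. *)
Definition transfinite_sequential (X : topologicalType) : Prop :=
  forall U : set X,
    (forall d (I : orderType d), well_order (<=%O : rel I) ->
      [set: I] !=set0 ->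
      forall (u : I -> X) (x : X), U x -> u @ tails I --> x ->
        \forall i \near tails I, U (u i)) ->
    open U.

Definition TS : subcategory := full_on transfinite_sequential.

(* Main.v *)
From HB Require Import structures.
From mathcomp Require Import all_boot all_order.
From mathcomp Require Import boolp classical_sets cardinality filter wochoice.
From mathcomp Require Import topology_structure separation_axioms.
Require Import Defs.

(** Write oo for the point None.  In [beta_space P] and [gamma_space P], with P
directed, a set U is open when it meets P in an upper set, and contains some
member of P as soon as it contains oo; in [gamma_space P] it must in addition
contain oo as soon as it meets P ([open_betaP], [open_gammaP]).  A continuous
map from [beta_space P] to X is thus a net that increases in the specialization
order of X together with one of its limits, and a continuous map from
[gamma_space P] is such a net whose chosen limit is also an upper bound.

The inclusions.  A larger class of test spaces has fewer test-open sets, which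
gives the inclusions from N to I to D, with or without primes.  For the
inclusions from a primed class to the unprimed one, the two-point net shows that
a test-open set U for an unprimed class is an upper set in the specialization
order ([class_N_open_upper]); the extra condition for openness in
[gamma_space P] then holds for each inverse image of U
([C_generated_gamma_beta]).  An increasing net over a chain converges along a
well-ordered cofinal subset ([cofinal_well_order]), so spaces generated by
chains are transfinite sequential, and those generated by N are sequential.

Strictness.  Each test space is generated by any class that contains it, and the
singleton of oo is never open in it, so it suffices to find, for a given poset P
and a smaller class, that this singleton is test-open.
- Smaller index posets: if a continuous map from the space of Q to the space of
  P sends oo to oo and no point of Q to oo, then it restricts to a monotone map
  from Q onto a cofinal part of P ([beta_None_open], [gamma_None_open]).  There
  is none from the natural numbers to a chain J of uncountable cofinality such
  as the first uncountable ordinal, and none from any chain to the product of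
  the natural numbers with J ([no_cofinal_sequence], [no_cofinal_chain]).
- Primed against unprimed: in [beta_space nat] the point oo is incomparable to
  all others, so a net having oo as limit and upper bound is constant
  ([beta_not_D'_generated]).
- Unprimed against Top, TS and Seq: in a T1 space increasing nets are constant,
  so every subset is test-open for D ([T1_D_open]); the space of a nontrivial
  convergent sequence is T1 and sequential but not discrete. *)

Set Implicit Arguments.
Unset Strict Implicit.
Unset Printing Implicit Defensive.

Import Order.TTheory.

Local Open Scope classical_set_scope.

(** * Well-ordered types *)

Section WellOrder.
Variables (T : choiceType) (R : rel T).
Hypothesis woR : well_order R.

Let wo_chainR : wo_chain R [pred _ | true].
Proof. exact: (withinW woR). Qed.

Lemma well_order_refl : reflexive R.
Proof. by move=> x; exact: (wo_chain_reflexive wo_chainR). Qed.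

Lemma well_order_anti : antisymmetric R.
Proof. by move=> x y; exact: (wo_chain_antisymmetric wo_chainR). Qed.

Lemma well_order_total : total R.
Proof. by move=> x y; exact: (wo_chainW wo_chainR). Qed.

Lemma well_order_min (A : set T) : A !=set0 ->
  exists2 z, A z & forall y, A y -> R z y.
Proof.
case=> a Aa; have [|z [[zA zmin] _]] := woR (A := [pred x | `[< A x >]]).
  by exists a; exact: asboolT.
exists z; first exact: asboolW zA.
by move=> y Ay; apply: zmin; exact: asboolT.
Qed.

Lemma well_order_trans : transitive R.
Proof.
move=> y x z Rxy Ryz.
have [|m Am mmin] := @well_order_min [set t | t = x \/ t = y \/ t = z].
  by exists x; left.
case: Am mmin => [|[|]] -> mmin; first by apply: mmin; right; right.
- by rewrite (@well_order_anti x y) // Rxy mmin //; left.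
- by rewrite (@well_order_anti z y) // Ryz mmin //; right; left.
Qed.

Lemma well_order_sub (P : pred T) :
  well_order (relpre val R : rel {x : T | P x}).
Proof.
apply: antisymmetric_well_order => [x y xy|A [a Aa]].
  by apply: val_inj; exact: well_order_anti.
have [|_ [z Az <-] zmin] := @well_order_min (val @` [set x | x \in A]).
  by exists (val a); exists a.
by exists z; split => // y Ay; apply: zmin; exists y.
Qed.

(** The proof that R is a well-order is a parameter of the type, so that the
order instances below can be found from the type alone. *)
Definition wo_type of well_order R : Type := T.

Local Notation W := (wo_type woR).
HB.instance Definition _ := Choice.on W.
HB.instance Definition _ := @Order.Le_isPOrder.Build (Order.Disp tt tt) W R
  well_order_refl well_order_anti well_order_trans.
HB.instance Definition _ := Order.POrder_isTotal.Build (Order.Disp tt tt) W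
  well_order_total.

End WellOrder.

Lemma nat_well_order : well_order (<=%O : rel nat).
Proof.
apply: antisymmetric_well_order => [|A [a Aa]]; first exact: le_anti.
have exA : exists n, n \in A by exists a.
exists (ex_minn exA); by case: ex_minnP => m Am mmin; split.
Qed.

(** Cantor's diagonal argument, applied to an injection of the power set into
the natural numbers. *)
Lemma uncountable_power_nat : ~ countable [set: set nat].
Proof.
case/countable_injP => f finj.
pose D := [set n | exists2 A : set nat, f A = n & ~ A n].
have nD : ~ D (f D).
  by move=> /[dup] DfD [A /finj]; rewrite !in_setT => /(_ isT isT) ->.
by apply: (nD); exists D.
Qed.

(** The chain is the first uncountable ordinal, realized as the set J of points
with countable initial segment in a well-order of the power set of the natural
numbers.  J is uncountable, while a cofinal sequence would
cover it by countably many countable initial segments. *)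
Lemma uncountable_cofinality_chain :
  exists d (I : orderType d), [set: I] !=set0 /\
    forall s : nat -> I, exists j, forall n, (s n < j)%O.
Proof.
have [R woR] := well_ordering_principle (set nat).
pose J : pred (set nat) := fun x => `[< countable [set y | R y x] >].
have Junc : ~ countable [set x | J x].
  move=> cJ; apply: uncountable_power_nat.
  have [JT|/existsNP nJT] := pselect (forall x, J x).
    by apply: sub_countable cJ; apply: subset_card_le => x _; exact: JT.
  (* J is closed downwards, so the least point z outside J has its initial
     segment in J with z added; that segment is countable, a contradiction. *)
  have [z nJz zmin] := well_order_min (A := [set x | ~ J x]) woR nJT.
  exfalso; apply: nJz; apply/asboolP.
  have cJz : countable (\bigcup_(b in [set: bool])
      if b then [set x | J x] else [set z]).
    by apply: bigcup_countable => // -[].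
  apply: sub_countable cJz; apply: subset_card_le => y Ryz.
  have [Jy|nJy] := pselect (J y); first by exists true.
  by exists false => //; apply: (well_order_anti woR); rewrite Ryz zmin.
pose I := wo_type (@well_order_sub _ R woR J).
exists (Order.Disp tt tt), I; split.
  apply: contrapT => I0; apply: Junc.
  apply: sub_countable (countable0 (set nat)).
  by apply: subset_card_le => x Jx; apply: I0; exists (exist _ x Jx).
move=> s; apply: contrapT => /forallNP s_cof; apply: Junc.
have cU : countable (\bigcup_(n in [set: nat]) [set y | R y (val (s n))]).
  by apply: bigcup_countable => // n _; have /asboolP := valP (s n).
apply: sub_countable cU; apply: subset_card_le => x Jx.
have /existsNP[n] := s_cof (exist _ x Jx).
move=> /negP; rewrite -leNgt => xs; by exists n.
Qed.

(** * The specialization order *)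

Definition spec_le (X : topologicalType) (x y : X) :=
  forall A : set X, open A -> A x -> A y.

Definition spec_upper (X : topologicalType) (U : set X) :=
  forall x y : X, spec_le x y -> U x -> U y.

Lemma spec_le_nbhs (X : topologicalType) (x y : X) (A : set X) :
  spec_le x y -> nbhs x A -> A y.
Proof. by rewrite nbhsE => xy [B [Bop Bx] BA]; apply: BA; exact: xy Bop Bx. Qed.

Lemma T0_of_spec_anti (X : topologicalType) :
  (forall x y : X, spec_le x y -> spec_le y x -> x = y) -> kolmogorov_space X.
Proof.
move=> anti x y /eqP xy.
have sep (a b : X) : ~ spec_le a b ->
    exists A : set X, A \in nbhs a /\ b \in ~` A.
  move=> /existsNP[A] /not_implyP[Aop] /not_implyP[Aa nAb].
  by exists A; rewrite !inE; split=> //; apply: open_nbhs_nbhs.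
have [xley|/sep[A ?]] := pselect (spec_le x y); last by exists A; left.
have [ylex|/sep[A ?]] := pselect (spec_le y x); last by exists A; right.
by case: xy; exact: anti.
Qed.

(** * Topologies generated by a subbase *)

Section Subbase.
Variables (T : choiceType) (B : set (set T)).

(* The generated topology, written as it unfolds for a space built from the
   subbase B. *)
Let generated : set (set T) :=
  [set \bigcup_(A in F) A | F in [set F | F `<=` finI_from B id]].

Lemma subbase_generated A : B A -> generated A.
Proof.
move=> BA; exists [set A]; last by rewrite bigcup_set1.
by move=> _ ->; exact: (@finI_from1 _ _ B id A).
Qed.

(** Any family that contains the subbase and satisfies the axioms of a topology
contains the generated topology. *)
Lemma generated_ind (op : set (set T)) :
    op setT -> setI_closed op ->
    (forall F : set (set T), F `<=` op -> op (\bigcup_(A in F) A)) ->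
    B `<=` op ->
  generated `<=` op.
Proof.
move=> opT opI opU Bop _ [F Ffin <-]; apply: opU => A /Ffin[s sB <-].
rewrite bigcap_fset big_seq; elim/big_ind: _ => // i /sB.
by rewrite inE => /Bop.
Qed.

End Subbase.

(** * The spaces attached to a directed poset *)

Section DirectedPoset.
Context d (P : porderType d).
Hypothesis dirP : directed_poset P.

(** Directedness makes the condition at None stable under binary
intersection, and nonemptiness makes it true of the whole space. *)
Lemma open_betaP (U : set (beta_space P)) :
  open U <-> (forall x y : P, (x <= y)%O -> U (Some x) -> U (Some y)) /\
             (U None -> exists z, U (Some z)).
Proof.
split=> [|[Uup Ulim]].
  move: U; apply: generated_ind; rewrite /=.
  - by split=> // _; case: dirP => -[z _] _; exists z.
  - move=> A A' [Aup Alim] [Bup Blim].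
    split=> [x y xy [Ax Bx]|[/Alim[a Aa] /Blim[b Bb]]].
      by split; [exact: Aup Ax | exact: Bup Bx].
    have [z [az bz]] := dirP.2 a b.
    by exists z; split; [exact: Aup Aa | exact: Bup Bb].
  - move=> F Fop; split=> [x y xy [A FA Ax]|[A FA]].
      by exists A => //; exact: (Fop _ FA).1 Ax.
    by move=> /((Fop _ FA).2)[z Az]; exists z; exists A.
  - move=> _ [] [x _ <-].
      split=> [y z yz [w xw [wy]]|[w _]//].
      by exists z => //; rewrite -wy in yz; exact: le_trans yz.
    split=> [y z yz [[w xw [wy]]|//]|_].
      by left; exists z => //; rewrite -wy in yz; exact: le_trans yz.
    by exists x; left; exists x => //; exact: lexx.
rewrite openE => -[x Ux|/[dup] UN /Ulim[z Uz]].
  exists (Some @` up x); split.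
  - by apply: subbase_generated; left; exists x.
  - by exists x => //; exact: lexx.
  - by move=> _ [y xy <-]; exact: Uup Ux.
exists ((Some @` up z) `|` [set None]); split.
- by apply: subbase_generated; right; exists z.
- by right.
- by move=> _ [[y zy <-]|->//]; exact: Uup Uz.
Qed.

Lemma open_gammaP (U : set (gamma_space P)) :
  open U <-> [/\ forall x y : P, (x <= y)%O -> U (Some x) -> U (Some y),
                 forall x, U (Some x) -> U None &
                 U None -> exists z, U (Some z)].
Proof.
split=> [|[Uup UNone Ulim]].
  move: U; apply: generated_ind; rewrite /=.
  - by split=> // _; case: dirP => -[z _] _; exists z.
  - move=> A A' [Aup AN Alim] [Bup BN Blim].
    split=> [x y xy [Ax Bx]|x [Ax Bx]|[/Alim[a Aa] /Blim[b Bb]]].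
    + by split; [exact: Aup Ax | exact: Bup Bx].
    + by split; [exact: AN Ax | exact: BN Bx].
    have [z [az bz]] := dirP.2 a b.
    by exists z; split; [exact: Aup Aa | exact: Bup Bb].
  - move=> F Fop; split=> [x y xy [A FA Ax]|x [A FA Ax]|[A FA]];
      have [Aup AN Alim] := Fop _ FA.
    + by exists A => //; exact: Aup Ax.
    + by exists A => //; exact: AN Ax.
    by move=> /Alim[z Az]; exists z; exists A.
  - move=> _ [x _ <-].
    split=> [y z yz [[w xw [wy]]|//]|y _|_].
    + by left; exists z => //; rewrite -wy in yz; exact: le_trans yz.
    + by right.
    by exists x; left; exists x => //; exact: lexx.
rewrite openE.
suff nb x u : U (Some x) -> ((Some @` up x) `|` [set None]) u -> U° u.
  move=> [x|/Ulim[x]] Ux; apply: (nb x) => //; last by right.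
  by left; exists x => //; exact: lexx.
move=> Ux xu; exists ((Some @` up x) `|` [set None]); split=> //.
  by apply: subbase_generated; exists x.
by move=> _ [[y xy <-]|->]; [exact: Uup Ux | exact: UNone Ux].
Qed.

Lemma continuous_betaP (X : topologicalType) (k : beta_space P -> X) :
  continuous k <->
  (forall x y : P, (x <= y)%O -> spec_le (k (Some x)) (k (Some y))) /\
  (forall A, open A -> A (k None) -> exists z, A (k (Some z))).
Proof.
rewrite continuousP; split=> [kop|[kup klim] A Aop].
  split=> [x y xy A /kop/open_betaP[Aup _]|A /kop/open_betaP[_ Alim]] //.
  exact: Aup.
by apply/open_betaP; split=> [x y xy|]; [exact: kup | exact: klim].
Qed.

Lemma continuous_gammaP (X : topologicalType) (k : gamma_space P -> X) :
  continuous k <->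
  [/\ forall x y : P, (x <= y)%O -> spec_le (k (Some x)) (k (Some y)),
      forall x, spec_le (k (Some x)) (k None) &
      forall A, open A -> A (k None) -> exists z, A (k (Some z))].
Proof.
rewrite continuousP; split=> [kop|[kup kN klim] A Aop].
  split=> [x y xy A /kop/open_gammaP[Aup _ _]|x A|A] //.
  - exact: Aup.
  - by move=> /kop/open_gammaP[_ AN _]; exact: AN.
  - by move=> /kop/open_gammaP[_ _].
by apply/open_gammaP; split=> [x y xy|x|];
  [exact: kup | exact: kN | exact: klim].
Qed.

Lemma continuous_gamma_beta (X : topologicalType) (k : option P -> X) :
  continuous (k : gamma_space P -> X) -> continuous (k : beta_space P -> X).
Proof. by move=> /continuous_gammaP[kup _ klim]; apply/continuous_betaP. Qed.

(** The two topologies differ only by the condition that an open set meeting P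
contains None; for an inverse image it follows from k (Some x) being below
k None. *)
Lemma open_beta_gamma (X : topologicalType) (k : gamma_space P -> X)
    (U : set X) :
  continuous k -> spec_upper U ->
  open (k @^-1` U : set (beta_space P)) ->
  open (k @^-1` U : set (gamma_space P)).
Proof.
move=> /continuous_gammaP[_ kN _] Uup /open_betaP[Vup Vlim].
by apply/open_gammaP; split=> // x; exact: Uup (kN x).
Qed.

Lemma beta_None_not_open : ~ open ([set None] : set (beta_space P)).
Proof. by move=> /open_betaP[_ /(_ erefl)[]]. Qed.

Lemma gamma_None_not_open : ~ open ([set None] : set (gamma_space P)).
Proof. by move=> /open_gammaP[_ _ /(_ erefl)[]]. Qed.

Lemma beta_spec_le_Some (x y : P) :
  spec_le (Some x : beta_space P) (Some y) -> (x <= y)%O.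
Proof.
have op : open ([set u | if u is Some z then (x <= z)%O else false]
    : set (beta_space P)).
  by apply/open_betaP; split=> //= a b ab xa; exact: le_trans ab.
by move=> /(_ _ op); apply; exact: lexx.
Qed.

Lemma beta_not_spec_le_None (x : P) :
  ~ spec_le (Some x : beta_space P) None.
Proof.
have op : open ([set u | u <> None] : set (beta_space P)).
  by apply/open_betaP; split=> //.
by move=> /(_ _ op) /(_ _ erefl); apply.
Qed.

Lemma open_gamma_up (x : P) :
  open ([set u | if u is Some z then (x <= z)%O else true]
    : set (gamma_space P)).
Proof.
apply/open_gammaP; split=> //= [a b ab xa|_]; first exact: le_trans ab.
by exists x; exact: lexx.
Qed.

Lemma gamma_spec_le_Some (x y : P) :
  spec_le (Some x : gamma_space P) (Some y) -> (x <= y)%O.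
Proof. by move=> /(_ _ (open_gamma_up x)); apply; exact: lexx. Qed.

Lemma gamma_spec_le_None (u : gamma_space P) :
  no_largest P -> spec_le (None : gamma_space P) u -> u = None.
Proof.
case: u => // y Pnl leNy; case: Pnl; exists y => x.
by have /= := leNy _ (open_gamma_up x); exact.
Qed.

(** The topology beta is finer than gamma. *)
Lemma continuous_id_beta_gamma :
  continuous (id : beta_space P -> gamma_space P).
Proof. by apply: (@continuous_gamma_beta (gamma_space P) id) => x. Qed.

Lemma beta_spec_le_None (u : beta_space P) :
  no_largest P -> spec_le (None : beta_space P) u -> u = None.
Proof.
move=> Pnl leNu; apply: (gamma_spec_le_None Pnl) => A Aop.
have /continuousP/(_ _ Aop) := continuous_id_beta_gamma.
exact: leNu.
Qed.

Lemma beta_T0 : kolmogorov_space (beta_space P).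
Proof.
apply: T0_of_spec_anti => -[x|] [y|] //.
- move=> /beta_spec_le_Some xy /beta_spec_le_Some yx.
  by congr Some; apply: le_anti; rewrite xy yx.
- by move=> /beta_not_spec_le_None.
- by move=> _ /beta_not_spec_le_None.
Qed.

Lemma gamma_T0 : no_largest P -> kolmogorov_space (gamma_space P).
Proof.
move=> Pnl; apply: T0_of_spec_anti => -[x|] [y|] //.
- move=> /gamma_spec_le_Some xy /gamma_spec_le_Some yx.
  by congr Some; apply: le_anti; rewrite xy yx.
- by move=> _ /gamma_spec_le_None ->.
- by move=> /gamma_spec_le_None ->.
Qed.

End DirectedPoset.

Lemma directed_chain d (I : orderType d) : [set: I] !=set0 -> directed_poset I.
Proof.
move=> I0; split=> // x y; exists (Order.max x y).
by rewrite !le_max !lexx orbT.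
Qed.

Lemma directed_nat : directed_poset nat.
Proof. by apply: directed_chain; exists 0. Qed.

Lemma directed_prod d (P : porderType d) d' (Q : porderType d') :
  directed_poset P -> directed_poset Q -> directed_poset (P *p Q)%type.
Proof.
move=> [[p _] dP] [[q _] dQ]; split; first by exists (p, q).
move=> [x1 x2] [y1 y2]; have [z1 [xz1 yz1]] := dP x1 y1.
have [z2 [xz2 yz2]] := dQ x2 y2.
by exists (z1, z2); rewrite !leEprod /= xz1 xz2 yz1 yz2.
Qed.

Lemma no_largest_nat : no_largest nat.
Proof. by case=> m /(_ m.+1); rewrite leEnat ltnn. Qed.

(** * Cofinality *)

Definition has_cofinal_map d (Q : porderType d) d' (P : porderType d') :=
  exists2 f : Q -> P, {homo f : x y / (x <= y)%O} &
    forall p, exists q, (p <= f q)%O.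

Lemma no_largest_of_cofinality d (Q : porderType d) d' (P : porderType d') :
  directed_poset Q -> ~ has_cofinal_map Q P -> no_largest P.
Proof.
move=> [[q _] _] nQP [m mmax]; apply: nQP.
by exists (fun=> m) => // p; exists q; exact: mmax.
Qed.

(** As beta is finer than gamma, the mixed case handled here covers maps between
two beta spaces and maps between two gamma spaces.  If k maps None to None but
no Some q to None, then k restricts to a monotone map from Q to P, and
convergence to None makes it cofinal. *)
Lemma beta_gamma_None_open d (Q : porderType d) d' (P : porderType d')
    (k : beta_space Q -> gamma_space P) :
  directed_poset Q -> directed_poset P -> ~ has_cofinal_map Q P ->
  continuous k -> open (k @^-1` [set None]).
Proof.
move=> dQ dP nQP /(continuous_betaP dQ)[kup klim].
have Pnl := no_largest_of_cofinality dQ nQP.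
apply/open_betaP => //; split=> [x y xy /= kx|kN].
  by apply: gamma_spec_le_None => //; rewrite -kx; exact: kup.
apply: contrapT => /forallNP kS; apply: nQP.
have [[p0 _] _] := dP.
pose f q := odflt p0 (k (Some q)).
have kE q : k (Some q) = Some (f q).
  by move: (kS q); rewrite /f /=; case: (k (Some q)).
exists f => [x y xy|p].
  by apply: (gamma_spec_le_Some dP); rewrite -!kE; exact: kup.
have [|q] := klim _ (open_gamma_up dP p); first by rewrite kN.
by rewrite kE; exists q.
Qed.

Lemma beta_None_open d (Q : porderType d) d' (P : porderType d')
    (k : beta_space Q -> beta_space P) :
  directed_poset Q -> directed_poset P -> ~ has_cofinal_map Q P ->
  continuous k -> open (k @^-1` [set None]).
Proof.
move=> dQ dP nQP kc.
apply: (@beta_gamma_None_open _ _ _ _ (k : _ -> gamma_space P)) => //.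
by move=> x; apply: (@continuous_comp _ _ (gamma_space P) k id);
  [exact: kc | exact: (continuous_id_beta_gamma dP)].
Qed.

Lemma gamma_None_open d (Q : porderType d) d' (P : porderType d')
    (k : gamma_space Q -> gamma_space P) :
  directed_poset Q -> directed_poset P -> ~ has_cofinal_map Q P ->
  continuous k -> open (k @^-1` [set None]).
Proof.
move=> dQ dP nQP kc; apply: open_beta_gamma => //.
  have Pnl := no_largest_of_cofinality dQ nQP.
  move=> x y xy xN; apply: gamma_spec_le_None Pnl _ => //.
  by rewrite -[None]xN.
by apply: beta_gamma_None_open => //; exact: continuous_gamma_beta.
Qed.

Lemma no_cofinal_sequence d (I : orderType d) :
  (forall s : nat -> I, exists j, forall n, (s n < j)%O) ->
  ~ has_cofinal_map nat I.
Proof.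
move=> unc [f _ fcof]; have [j fj] := unc f; have [n] := fcof j.
by rewrite leNgt fj.
Qed.

(** Suppose f is cofinal and choose i n with (f (i n)).1 at least n.  The second
components of the f (i n) are bounded strictly by some j, and some f t has
second component at least j.  Then t lies above every i n, and the first
component of f t is at least every natural number. *)
Lemma no_cofinal_chain d (I : orderType d) d' (J : orderType d') (j0 : J) :
  (forall s : nat -> J, exists j, forall n, (s n < j)%O) ->
  ~ has_cofinal_map I (nat *p J)%type.
Proof.
move=> unc [f fmono fcof].
have /choice[i fi] n : exists i, (n <= (f i).1)%O.
  have [i] := fcof ((n, j0) : nat *p J).
  by rewrite leEprod => /andP[? _]; exists i.
have [j sj] := unc (fun n => (f (i n)).2).
have [t] := fcof ((0, j) : nat *p J); rewrite leEprod => /andP[_ jt].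
have it n : (n <= (f t).1)%O.
  have [tin|/ltW int] := leP t (i n).
    have := sj n; rewrite ltNge (le_trans jt) //.
    by have := fmono _ _ tin; rewrite leEprod => /andP[].
  apply: le_trans (fi n) _.
  by have := fmono _ _ int; rewrite leEprod => /andP[].
by have := it (f t).1.+1; rewrite leEnat ltnn.
Qed.

(** * Inclusions between the classes of generated spaces *)

Lemma class_N_I S : class_N S -> class_I S.
Proof. by case; apply: Class_I; exists 0. Qed.

Lemma class_I_D S : class_I S -> class_D S.
Proof. by case=> d I I0; apply: Class_D; exact: directed_chain. Qed.

Lemma class_N'_I' S : class_N' S -> class_I' S.
Proof. by case; apply: Class_I'; [exists 0 | exact: no_largest_nat]. Qed.

Lemma class_I'_D' S : class_I' S -> class_D' S.
Proof. by case=> d I I0 nl; apply: Class_D' => //; exact: directed_chain. Qed.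

Lemma C_generated_sub (C C' : topologicalType -> Prop) X :
  (forall S, C S -> C' S) -> C_generated C X -> C_generated C' X.
Proof. by move=> CC' genX U Uop; apply: genX => S k /CC'; exact: Uop. Qed.

Lemma C_generated_self (C : topologicalType -> Prop) S :
  C S -> C_generated C S.
Proof. by move=> CS U /(_ S id CS); apply => x. Qed.

(** If x is below y, the sequence x, y, y, ... increases and converges to y. *)
Lemma class_N_open_upper (X : topologicalType) (U : set X) :
  C_open class_N U -> spec_upper U.
Proof.
move=> Uop x y xy Ux.
pose k (o : beta_space nat) := if o is Some 0 then x else y.
have kc : continuous k.
  apply/(continuous_betaP directed_nat); split=> [[|m] [|n] _|A _ Ay] //=.
  by exists 1.
have /(open_betaP directed_nat)[Uup _] := Uop _ k Class_N kc.
exact: Uup 0 1 isT Ux.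
Qed.

Lemma C_generated_gamma_beta (C C' : topologicalType -> Prop) X :
    (forall S, class_N S -> C S) ->
    (forall S, C' S -> exists d (P : porderType d),
      [/\ directed_poset P, C (beta_space P) & S = gamma_space P]) ->
  C_generated C' X -> C_generated C X.
Proof.
move=> NC C'C genX U Uop; apply: genX => S k /C'C[d [P [dP CP SE]]].
case: _ / (esym SE) k => k kc; apply: open_beta_gamma => //.
  by apply: class_N_open_upper => S' k' /NC; exact: Uop.
by apply: Uop => //; exact: continuous_gamma_beta.
Qed.

Lemma D'_generated_D X : C_generated class_D' X -> C_generated class_D X.
Proof.
apply: C_generated_gamma_beta => [S /class_N_I/class_I_D//|_ [d P dP _]].
by exists d, P; split=> //; exact: Class_D.
Qed.

Lemma I'_generated_I X : C_generated class_I' X -> C_generated class_I X.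
Proof.
apply: C_generated_gamma_beta => [S /class_N_I//|_ [d I I0 _]].
by exists d, I; split; [exact: directed_chain | exact: Class_I |].
Qed.

Lemma N'_generated_N X : C_generated class_N' X -> C_generated class_N X.
Proof.
apply: C_generated_gamma_beta => [S //|_ []].
by exists _, nat; split=> //; exact: directed_nat.
Qed.

Lemma N_generated_sequential X : C_generated class_N X -> sequential X.
Proof.
move=> genX U Useq; apply: genX => S k cS; case: S / cS k => k.
move=> /(continuous_betaP directed_nat)[kup klim].
apply/(open_betaP directed_nat); split=> [x y xy Ux|UN].
  have [|N _ UN] := Useq (fun=> k (Some y)) _ Ux; last exact: (UN N (leqnn N)).
  move=> A /(spec_le_nbhs (kup _ _ xy)) Ay.
  by exists 0 => // n _; exact: Ay.
have [|N _ UN'] := Useq (fun n => k (Some n)) _ UN.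
  move=> A; rewrite nbhsE => -[B [Bop /(klim _ Bop)[z Bz]] BA].
  by exists z => // n zn; apply: BA; exact: kup zn _ Bop Bz.
by exists N; exact: (UN' N (leqnn N)).
Qed.

(** Fix a well-order R of I, unrelated to the given order, and keep the points
that dominate all their R-predecessors.  On these points R agrees with the order
of I.  They are cofinal: the R-least point above i is one of them. *)
Lemma cofinal_well_order d (I : orderType d) : [set: I] !=set0 ->
  exists d' (W : orderType d') (f : W -> I),
  [/\ well_order (<=%O : rel W), [set: W] !=set0,
      {homo f : x y / (x <= y)%O} & forall i, exists w, (i <= f w)%O].
Proof.
move=> [i0 _]; have [R woR] := well_ordering_principle I.
pose J : pred I := fun y => `[< forall j, R j y -> (j <= y)%O >].
have Jcof i : exists2 j, J j & (i <= j)%O.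
  have [|j ij jmin] := well_order_min (A := [set j | (i <= j)%O]) woR.
    by exists i; exact: lexx.
  exists j => //; apply/asboolP => t Rtj.
  have [it|/ltW ti] := leP i t; last exact: le_trans ti ij.
  by rewrite (@well_order_anti _ _ woR t j) // Rtj jmin.
have woJ := @well_order_sub _ R woR J.
exists (Order.Disp tt tt), (wo_type woJ), val; split => //.
- by have [j Jj _] := Jcof i0; exists (exist _ j Jj).
- by move=> x y xy; have /asboolP := valP y; exact.
- by move=> i; have [j Jj ij] := Jcof i; exists (exist _ j Jj).
Qed.

(** Convergence at points of I is tested by constant transfinite sequences, and
convergence at None by the restriction to a well-ordered cofinal subset. *)
Lemma I_generated_transfinite X :
  C_generated class_I X -> transfinite_sequential X.
Proof.
move=> genX U Utrans; apply: genX => S k cS; case: S / cS k => d I I0 k.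
have dI := directed_chain I0.
move=> /(continuous_betaP dI)[kup klim].
have [d' [W [f [woW W0 fmono fcof]]]] := cofinal_well_order I0.
apply/(open_betaP dI); split=> [x y xy Ux|UN].
  have [|w _ Uw] := Utrans _ W woW W0 (fun=> k (Some y)) _ Ux.
    move=> A /(spec_le_nbhs (kup _ _ xy)) Ay.
    by have [w _] := W0; exists w => // n _; exact: Ay.
  by apply: (Uw w); exact: lexx.
have [|w _ Uw] := Utrans _ W woW W0 (fun w => k (Some (f w))) _ UN.
  move=> A; rewrite nbhsE => -[B [Bop /(klim _ Bop)[z Bz]] BA].
  have [w zw] := fcof z; exists w => // v wv; apply: BA.
  by apply: kup Bop Bz; apply: le_trans zw _; exact: fmono.
by exists (f w); apply: (Uw w); exact: lexx.
Qed.

Lemma sequential_transfinite X : sequential X -> transfinite_sequential X.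
Proof.
move=> seqX U Utrans; apply: seqX => u x Ux ux.
have nat0 : [set: nat] !=set0 by exists 0.
exact: (Utrans _ nat nat_well_order nat0 u x Ux ux).
Qed.

(** * Separating spaces *)

Lemma beta_not_N_generated d (P : porderType d) : directed_poset P ->
  ~ has_cofinal_map nat P -> ~ C_generated class_N (beta_space P).
Proof.
move=> dP nP /(_ [set None]) genP.
apply: (beta_None_not_open dP); apply: genP => S k cS; case: S / cS k => k.
by apply: beta_None_open => //; exact: directed_nat.
Qed.

Lemma gamma_not_N'_generated d (P : porderType d) : directed_poset P ->
  ~ has_cofinal_map nat P -> ~ C_generated class_N' (gamma_space P).
Proof.
move=> dP nP /(_ [set None]) genP.
apply: (gamma_None_not_open dP); apply: genP => S k cS; case: S / cS k => k.
by apply: gamma_None_open => //; exact: directed_nat.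
Qed.

Lemma beta_not_I_generated d (P : porderType d) : directed_poset P ->
  (forall d' (I : orderType d'), ~ has_cofinal_map I P) ->
  ~ C_generated class_I (beta_space P).
Proof.
move=> dP nP /(_ [set None]) genP.
apply: (beta_None_not_open dP); apply: genP => S k cS.
case: S / cS k => d' I I0 k.
by apply: beta_None_open => //; exact: directed_chain.
Qed.

Lemma gamma_not_I'_generated d (P : porderType d) : directed_poset P ->
  (forall d' (I : orderType d'), ~ has_cofinal_map I P) ->
  ~ C_generated class_I' (gamma_space P).
Proof.
move=> dP nP /(_ [set None]) genP.
apply: (gamma_None_not_open dP); apply: genP => S k cS.
case: S / cS k => d' I I0 _ k.
by apply: gamma_None_open => //; exact: directed_chain.
Qed.

(** In the specialization order of [beta_space P] the point None is comparable
only to itself, so the inverse image of the singleton of None is empty or the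
whole space. *)
Lemma beta_not_D'_generated d (P : porderType d) :
  directed_poset P -> no_largest P -> ~ C_generated class_D' (beta_space P).
Proof.
move=> dP Pnl /(_ [set None]) genP.
apply: (beta_None_not_open dP); apply: genP => S k cS.
case: S / cS k => d' Q dQ _ k /(continuous_gammaP dQ)[kup kN klim].
apply/(open_gammaP dQ); split=> [x y xy /= kx|x /= kx|/= kNone].
- by apply: (beta_spec_le_None dP Pnl); rewrite -kx; exact: kup.
- by apply: (beta_spec_le_None dP Pnl); rewrite -kx; exact: kN.
have [[q _] _] := dQ; exists q; move: (kN q); rewrite kNone.
by case: (k (Some q)) => // p /(beta_not_spec_le_None dP).
Qed.

(** In a space with trivial specialization order every increasing net over a
directed poset is constant, and so is the map with its limit added. *)
Lemma T1_D_open (X : topologicalType) (U : set X) :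
  (forall x y : X, spec_le x y -> x = y) -> C_open class_D U.
Proof.
move=> T1 S k cS; case: S / cS k => d P dP k.
move=> /(continuous_betaP dP)[kup klim].
have kS x y : k (Some x) = k (Some y).
  have [z [xz yz]] := dP.2 x y.
  by rewrite (T1 _ _ (kup _ _ xz)) (T1 _ _ (kup _ _ yz)).
have kN x : k None = k (Some x).
  by apply: T1 => A Aop /(klim _ Aop)[z]; rewrite (kS z x).
apply/(open_betaP dP); split=> [x y _ /=|/= UN]; first by rewrite (kS x y).
by have [[z _] _] := dP; exists z; rewrite -kN.
Qed.

(** A discrete sequence with a limit point None added: the one-point
compactification of the discrete natural numbers. *)
Definition conv_seq : Type := option nat.

Definition conv_seq_open : set_system conv_seq :=
  [set U | U None -> \forall n \near \oo, U (Some n)].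

Fact conv_seq_openT : conv_seq_open setT.
Proof. by move=> _; exact: nearW. Qed.

Fact conv_seq_openI : setI_closed conv_seq_open.
Proof. by move=> A B Aop Bop [/Aop AN /Bop BN]; exact: filterI. Qed.

Fact conv_seq_open_bigU (J : Type) (F : J -> set conv_seq) :
  (forall j, conv_seq_open (F j)) -> conv_seq_open (\bigcup_j F j).
Proof.
move=> Fop [j _ /Fop FN]; apply: filterS FN => n Fn.
by exists j.
Qed.

HB.instance Definition _ := Choice.on conv_seq.
HB.instance Definition _ := isOpenTopological.Build conv_seq
  conv_seq_openT conv_seq_openI conv_seq_open_bigU.

Lemma conv_seq_openE (U : set conv_seq) :
  open U = (U None -> \forall n \near \oo, U (Some n)).
Proof. by []. Qed.

Lemma conv_seq_T1 (x y : conv_seq) : spec_le x y -> x = y.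
Proof.
move=> xy; case: x xy => [n|] xy.
  have op : open ([set Some n] : set conv_seq) by rewrite conv_seq_openE.
  exact/esym/(xy _ op).
case: y xy => // n xy.
have op : open (~` [set Some n] : set conv_seq).
  by rewrite conv_seq_openE => _; exists n.+1 => // m /= nm [mn];
    rewrite mn ltnn in nm.
by have := xy _ op; case.
Qed.

Lemma conv_seq_T0 : kolmogorov_space conv_seq.
Proof. by apply: T0_of_spec_anti => x y /conv_seq_T1. Qed.

(** The defining sequence n |-> Some n converges to None and already tests
openness. *)
Lemma conv_seq_sequential : sequential conv_seq.
Proof.
move=> U Useq; rewrite conv_seq_openE => UN; apply: Useq UN _ => A.
rewrite nbhsE => -[B [Bop /Bop BN] BA].
by apply: filterS BN => n; exact: BA.
Qed.

Lemma conv_seq_not_D_generated : ~ C_generated class_D conv_seq.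
Proof.
move=> gen; have op : open ([set None] : set conv_seq).
  by apply/gen/T1_D_open/conv_seq_T1.
by have [N _ /(_ N (leqnn N))] := op erefl.
Qed.

Lemma proper_full_on (K K' : topologicalType -> Prop) :
    (forall X, K X -> K' X) ->
    (exists X, [/\ kolmogorov_space X, K' X & ~ K X]) ->
  proper_full_subcategory (full_on K) (full_on K').
Proof.
move=> KK' [X [X0 K'X nKX]]; split; last first.
  move=> /(congr1 (fun A => ob A X)) /= E.
  by have [] : kolmogorov_space X /\ K X by rewrite E.
split=> [Y [Y0 /KK' KY]|Y Z f [Y0 KY] [Z0 KZ]]; first by split.
by split=> -[_ _ fc]; split=> //; split=> //; exact: KK'.
Qed.

Theorem proposition43 :
  ((proper_full_subcategory (Top_gen class_N) (Top_gen class_I) /\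
    proper_full_subcategory (Top_gen class_I) (Top_gen class_D)) /\
   (proper_full_subcategory (Top_gen class_N') (Top_gen class_I') /\
    proper_full_subcategory (Top_gen class_I') (Top_gen class_D'))) /\
  ((proper_full_subcategory (Top_gen class_D') (Top_gen class_D) /\
    proper_full_subcategory (Top_gen class_D) Top) /\
   (proper_full_subcategory (Top_gen class_I') (Top_gen class_I) /\
    proper_full_subcategory (Top_gen class_I) TS) /\
   (proper_full_subcategory (Top_gen class_N') (Top_gen class_N) /\
    proper_full_subcategory (Top_gen class_N) Seq)).
Proof.
have N_I X := @C_generated_sub _ _ X class_N_I.
have I_D X := @C_generated_sub _ _ X class_I_D.
have N'_I' X := @C_generated_sub _ _ X class_N'_I'.
have I'_D' X := @C_generated_sub _ _ X class_I'_D'.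
have [d [J [J0 Junc]]] := uncountable_cofinality_chain.
have [j0 _] := J0.
have nNJ := no_cofinal_sequence Junc.
have dJ := directed_chain J0.
have nlJ := no_largest_of_cofinality directed_nat nNJ.
have dP : directed_poset (nat *p J)%type.
  by apply: directed_prod => //; exact: directed_nat.
have nIP d' (I : orderType d') := @no_cofinal_chain _ I _ _ j0 Junc.
have nlP := no_largest_of_cofinality directed_nat (nIP _ nat).
have N_beta : C_generated class_N (beta_space nat).
  exact: C_generated_self Class_N.
have beta_nD' := beta_not_D'_generated directed_nat no_largest_nat.
have beta_T0_nat := beta_T0 directed_nat.
split; [split; split | split; [split | split; split]]; apply: proper_full_on.
- exact: N_I.
- exists (beta_space J); split; first exact: beta_T0.
    by apply: C_generated_self; exact: Class_I.
  exact: beta_not_N_generated.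
- exact: I_D.
- exists (beta_space (nat *p J)%type); split; first exact: beta_T0.
    by apply: C_generated_self; exact: Class_D.
  exact: beta_not_I_generated.
- exact: N'_I'.
- exists (gamma_space J); split; first exact: gamma_T0.
    by apply: C_generated_self; exact: Class_I'.
  exact: gamma_not_N'_generated.
- exact: I'_D'.
- exists (gamma_space (nat *p J)%type); split; first exact: gamma_T0.
    by apply: C_generated_self; exact: Class_D'.
  exact: gamma_not_I'_generated.
- exact: D'_generated_D.
- by exists (beta_space nat); split=> //; exact/I_D/N_I.
- by [].
- exists conv_seq; split=> //; first exact: conv_seq_T0.
  exact: conv_seq_not_D_generated.
- exact: I'_generated_I.
- by exists (beta_space nat); split=> //; [exact: N_I | move=> /I'_D'].
- exact: I_generated_transfinite.
- exists conv_seq; split; first exact: conv_seq_T0.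
    exact/sequential_transfinite/conv_seq_sequential.
  by move=> /I_D/conv_seq_not_D_generated.
- exact: N'_generated_N.
- by exists (beta_space nat); split=> // /N'_I'/I'_D'.
- exact: N_generated_sequential.
- exists conv_seq; split; first exact: conv_seq_T0.
    exact: conv_seq_sequential.
  by move=> /N_I/I_D/conv_seq_not_D_generated.
Qed.
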